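(* Let $k\geq 2$ and $n\geq 0$ be integers. Then \[ \left|\mathcal{O}_{1,k}(n)\right|=\frac{1}{k-1}\left(\sum_{\lambda\in\mathcal{O}_k(n)}\ell(\lambda)-\sum_{\lambda\in\mathcal{D}_k(n)}\ell(\lambda)\right). \]
   Context: A partition of $n$ is a finite nonincreasing sequence of positive integers (its parts) summing to $n$; $\ell(\lambda)$ denotes the number of parts of $\lambda$ counted with multiplicity. For an integer $k\geq 1$: $\mathcal{O}_k(n)$ is the set of partitions of $n$ with no part divisible by $k$; $\mathcal{D}_k(n)$ is the set of partitions of $n$ in which no part occurs $k$ or more times; $\mathcal{O}_{1,k}(n)$ is the set of partitions of $n$ having exactly one distinct part value divisible by $k$ (this part may be repeated any number of times), all other parts being not divisible by $k$. *)

(* Defs.v *)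
From HB Require Import structures.
From mathcomp Require Import all_boot all_order all_algebra.

Set Implicit Arguments.
Unset Strict Implicit.
Unset Printing Implicit Defensive.

Definition is_partition (n : nat) (s : seq nat) : bool :=
  [&& sorted geq s, 0 \notin s & sumn s == n].

Record partition_of (n : nat) : Type := PartitionOf {
  parts :> seq nat;
  _ : is_partition n parts
}.

HB.instance Definition _ (n : nat) := [isSub for @parts n].
HB.instance Definition _ (n : nat) := [Countable of partition_of n by <:].

Lemma leq_mem_sumn (s : seq nat) (i : nat) : i \in s -> i <= sumn s.
Proof.
elim: s => //= a s IHs; rewrite inE => /orP[/eqP->|/IHs]; first exact: leq_addr.
by move/leq_trans; apply; apply: leq_addl.
Qed.

Lemma leq_size_sumn (s : seq nat) : 0 \notin s -> size s <= sumn s.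
Proof.
elim: s => //= a s IHs; rewrite inE negb_or eq_sym -lt0n => /andP[a0 /IHs].
by move=> les; rewrite -add1n leq_add.
Qed.

Lemma filter_mkseq (s : seq nat) (n : nat) : 0 \notin s -> size s <= n ->
  [seq x <- mkseq (nth 0 s) n | x != 0] = s.
Proof.
move=> s0 lesn; rewrite -(subnKC lesn) /mkseq iotaD map_cat filter_cat add0n.
rewrite -/(mkseq _ _) mkseq_nth.
have /all_filterP-> : all (fun x => x != 0) s.
  by apply/allP => x xs; apply: contraNneq s0 => <-.
rewrite -[RHS]cats0; congr (_ ++ _).
rewrite (eq_in_filter (a2 := pred0)) ?filter_pred0 // => x.
case/mapP => i; rewrite mem_iota => /andP[lei _] ->.
by rewrite /= nth_default.
Qed.

(* A partition of n has at most n parts, each at most n: pad it with zeros to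
   a sequence of n numbers at most n. This is only used to show finiteness. *)
Definition pad_parts (n : nat) (p : partition_of n) : n.-tuple 'I_n.+1 :=
  [tuple inord (nth 0 p i) | i < n].

Definition unpad_parts (n : nat) (t : n.-tuple 'I_n.+1) :
    option (partition_of n) :=
  insub [seq x <- map val t | x != 0].

Lemma pad_partsK (n : nat) : pcancel (@pad_parts n) (@unpad_parts n).
Proof.
move=> p; have /and3P[_ p0 /eqP sp] := valP p; rewrite /= in p0 sp.
rewrite /unpad_parts; set s := filter _ _.
suff -> : s = p by rewrite valK.
have lesn : size p <= n by rewrite -[leqRHS]sp leq_size_sumn.
rewrite /s; have -> : map val (pad_parts p) = mkseq (nth 0 p) n.
  rewrite /= -map_comp /mkseq -val_enum_ord -map_comp; apply: eq_map => i /=.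
  rewrite inordK // ltnS; have [lti|lei] := ltnP i (size p).
    by rewrite -[leqRHS]sp leq_mem_sumn ?mem_nth.
  by rewrite nth_default.
exact: filter_mkseq.
Qed.

HB.instance Definition _ (n : nat) : isFinite (partition_of n) :=
  PCanIsFinite (@pad_partsK n).

Definition partitionsO (k n : nat) : {set partition_of n} :=
  [set p : partition_of n | all (fun i => ~~ (k %| i)) p].

Definition partitionsD (k n : nat) : {set partition_of n} :=
  [set p : partition_of n | all (fun i => count_mem i p < k) p].

(* Exactly one part value is divisible by k, with arbitrary multiplicity. *)
Definition partitionsO1 (k n : nat) : {set partition_of n} :=
  [set p : partition_of n | size (undup [seq i <- p | k %| i]) == 1].

(* Main.v *)
(* With G_i = 1/(1 - q^i), the generating function of the partitions without
   multiples of k is F = prod_(k not dividing i) G_i, which by Euler and Glaisher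
   is also prod_i (1 - q^(ki)) G_i, the one of the partitions with multiplicities
   below k. Marking one copy of a part multiplies the first product by
   sum_(k not dividing i) (G_i - 1) and the second one by
   sum_i (G_i - 1 - k (G_(ki) - 1)); the difference of the two is
   (k - 1) F sum_(k divides i) (G_i - 1), and F sum_(k divides i) (G_i - 1) counts
   the partitions with exactly one part value divisible by k. All series are
   computed at a nilpotent x, finally the class of X modulo X^(n+1). *)
Require Import Defs.
From mathcomp Require Import all_boot all_order all_algebra.
From mathcomp Require Import ring.

Import GRing.Theory.
Local Open Scope ring_scope.

(** * Geometric sums of a nilpotent element *)

Lemma telescope_geom {A : comNzRingType} (k : nat) (y : A) :
  (1 - y) * \sum_(a < k) y ^+ a = 1 - y ^+ k.
Proof.
rewrite -[in RHS](expr1n A k) subrXX; congr (_ * _).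
by apply: eq_bigr => i _; rewrite expr1n mul1r.
Qed.

(** The series [1/(1 - y)] cut after degree [n], which loses nothing when [y ^+ n.+1 = 0]. *)
Definition geom {A : comNzRingType} (n : nat) (y : A) : A :=
  \sum_(a < n.+1) y ^+ a.

Lemma geomP {A : comNzRingType} (n : nat) (y : A) :
  y ^+ n.+1 = 0 -> (1 - y) * geom n y = 1.
Proof. by move=> y0; rewrite telescope_geom y0 subr0. Qed.

Lemma geom0 {A : comNzRingType} (n : nat) : geom n (0 : A) = 1.
Proof. by have := geomP n (0 : A); rewrite exprS mul0r subr0 mul1r; apply. Qed.

(** Both sums extend to a common range: terms with [a > n] vanish by nilpotency, and terms with
    [a >= k] are weighted by 0 or absent. *)
Lemma sum_trunc {A : comNzRingType} (n k : nat) (y : A) (f : nat -> nat) :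
  y ^+ n.+1 = 0 ->
  \sum_(a < n.+1) y ^+ a *+ ((a < k) * f a) = \sum_(a < k) y ^+ a *+ f a.
Proof.
move=> y0.
rewrite (big_ord_widen (n.+1 + k) (fun a => y ^+ a *+ ((a < k) * f a)))
  ?leq_addr //.
rewrite (big_ord_widen (n.+1 + k) (fun a => y ^+ a *+ f a)) ?leq_addl //.
rewrite big_mkcond [RHS]big_mkcond; apply: eq_bigr => a _.
have [lt_an|le_na] := ltnP a n.+1.
  by case: (a < k)%N; rewrite ?mul1n ?mul0n.
by rewrite -(subnK le_na) exprD y0 mulr0 mul0rn if_same.
Qed.

Lemma sum_geom_lt {A : comNzRingType} (n k : nat) (y : A) : y ^+ n.+1 = 0 ->
  \sum_(a < n.+1) y ^+ a *+ (a < k)%N = (1 - y ^+ k) * geom n y.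
Proof.
move=> y0; have := sum_trunc n k y (fun=> 1%N) y0.
under eq_bigr do rewrite muln1; move=> ->.
by rewrite -telescope_geom mulrAC geomP // mul1r.
Qed.

(** Logarithmic derivative: formally, [y d/dy] multiplies [(1 - y^k)/(1 - y)] by
    [y/(1 - y) - k y^k/(1 - y^k)], and [y/(1 - y)] is [geom n y - 1]. *)
Lemma sum_geom_weight {A : comNzRingType} (n k : nat) (y : A) :
  y ^+ n.+1 = 0 ->
  \sum_(a < n.+1) y ^+ a *+ ((a < k) * a) =
    (1 - y ^+ k) * geom n y * (geom n y - 1 - (geom n (y ^+ k) - 1) * k%:R).
Proof.
move=> y0; rewrite (sum_trunc _ _ _ id) //.
(* The case [k = 0] is separate because [y ^+ 0 = 1] is not nilpotent. *)
have [->|k0] := posnP k; first by rewrite big_ord0 subrr !mul0r.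
have yk0 : (y ^+ k) ^+ n.+1 = 0 by rewrite exprAC y0 expr0n gtn_eqF.
have eG := geomP n y y0; have eH := geomP n _ yk0.
(* Closed form of the sum with its denominator [(1 - y)^2] cleared. *)
have eS : (1 - y) ^+ 2 * \sum_(a < k) y ^+ a *+ a
    = y * (1 - y ^+ k) - y ^+ k * (1 - y) * k%:R.
  elim: k {k0 yk0 eH} => [|k IH]; first by rewrite big_ord0 expr0; ring.
  by rewrite big_ord_recr /= mulrDr IH -mulr_natr -natr1 [y ^+ k.+1]exprS; ring.
move: eS eG eH; move: (y ^+ k) (\sum_(a < k) _) (geom n y) (geom n (y ^+ k)).
move=> Y S G H eS eG eH.
have -> : S = G ^+ 2 * ((1 - y) ^+ 2 * S).
  by rewrite mulrA -exprMn [G * _]mulrC eG expr1n mul1r.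
have eG1 : G - 1 = y * G by rewrite -[1 in LHS]eG; ring.
have eH1 : (1 - Y) * (H - 1) = Y by rewrite mulrBr eH; ring.
have -> : (1 - Y) * G * (G - 1 - (H - 1) * k%:R)
    = (1 - Y) * G * (G - 1) - (1 - Y) * (H - 1) * G * k%:R by ring.
rewrite eS eH1 eG1.
(* Inserting [(1 - y) * G = 1] makes every term quadratic in [G], so that [ring] can conclude. *)
have -> : Y * G = Y * G * ((1 - y) * G) by rewrite eG mulr1.
ring.
Qed.

(** Multiplication by [k] is a bijection onto the positive multiples of [k], and those above [n]
    contribute only the neutral element. *)
Lemma big_multiples {R : Type} {idx : R} {op : Monoid.com_law idx} (k n : nat)
    (F : nat -> R) : (0 < k)%N -> (forall i, (n < i)%N -> F i = idx) ->
  \big[op/idx]_(i < n) F (i.+1 * k)%N =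
  \big[op/idx]_(i < n | (k %| i.+1)%N) F i.+1.
Proof.
move=> k0 F_large.
rewrite -(big_mkord xpredT (fun i => F (i.+1 * k)%N)).
rewrite -(big_mkord (fun i => (k %| i.+1)%N) (fun i => F i.+1)).
rewrite -(big_map (fun i => i.+1 * k)%N xpredT F).
rewrite -(big_map S (fun i => (k %| i)%N) F).
rewrite (bigID (fun i => (i <= n)%N)) /= [X in op _ X]big1 ?Monoid.mulm1; last first.
  by move=> i; rewrite -ltnNge; apply: F_large.
rewrite -big_filter -[RHS]big_filter; apply: perm_big.
apply: uniq_perm; rewrite ?filter_uniq // ?map_inj_uniq ?iota_uniq //.
- by move=> i j /eqP; rewrite eqn_pmul2r // => /eqP[].
- by move=> i j [].
move=> i; rewrite !mem_filter; apply/andP/andP => -[].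
  move=> le_in /mapP[j _ def_i]; rewrite def_i dvdn_mull //; split=> //.
  have i0 : (0 < i)%N by rewrite def_i muln_gt0 k0.
  by apply/mapP; exists i.-1; rewrite ?mem_index_iota prednK // -def_i.
move=> /dvdnP[q def_i] /mapP[j]; rewrite mem_index_iota => /andP[_ lt_jn] def_j.
have q0 : (0 < q)%N by case: q def_i => //; rewrite def_j mul0n.
rewrite def_j; split=> //; rewrite -def_j; apply/mapP; exists q.-1.
  by rewrite mem_index_iota prednK // (leq_trans _ lt_jn) // -def_j def_i leq_pmulr.
by rewrite prednK.
Qed.

(** * Weighted products of series and the identity between marked products *)

(* [w i a] is the weight of having exactly [a] parts equal to [i]. The truncations
   at [n] make coefficients above degree [n] meaningless. *)
Definition mult_gf {A : comNzRingType} (n : nat) (x : A) (w : nat -> nat -> nat)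
  : A := \prod_(i < n) \sum_(a < n.+1) (x ^+ i.+1) ^+ a *+ w i.+1 a.

(** Taking [v a = w j a * a] marks one copy of the part [j]; taking [v a = (0 < a)] forces [j] to
    occur. *)
Definition mark (w : nat -> nat -> nat) (j : nat) (v : nat -> nat) (i a : nat) :=
  if i == j then v a else w i a.

(** Only the factor of the part [j.+1] changes; [c] is the ratio of the new factor to the old one,
    expressed without division. *)
Lemma mult_gf_mark {A : comNzRingType} (n : nat) (x c : A)
    (w : nat -> nat -> nat) (j : 'I_n) (v : nat -> nat) :
  \sum_(a < n.+1) (x ^+ j.+1) ^+ a *+ v a =
    (\sum_(a < n.+1) (x ^+ j.+1) ^+ a *+ w j.+1 a) * c ->
  mult_gf n x (mark w j.+1 v) = mult_gf n x w * c.
Proof.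
move=> vE; rewrite /mult_gf (bigD1 j) //= [in RHS](bigD1 j) //= mulrAC -vE.
congr (_ * _); first by apply: eq_bigr => a _; rewrite /mark eqxx.
apply: eq_bigr => i neq_ij; apply: eq_bigr => a _.
by rewrite /mark eqSS val_eqE (negPf neq_ij).
Qed.

Definition weightO (k i a : nat) : nat := ~~ (k %| i)%N || (a == 0%N).
Definition weightD (k i a : nat) : nat := (a < k)%N.

Section TruncatedSeries.
Variables (A : comNzRingType) (n k : nat) (x : A).
Hypotheses (k_gt0 : (0 < k)%N) (xn0 : x ^+ n.+1 = 0).

Let G (i : nat) : A := geom n (x ^+ i).

Lemma nilpotent_exp (i : nat) : (0 < i)%N -> (x ^+ i) ^+ n.+1 = 0.
Proof. by move=> i0; rewrite exprAC xn0 expr0n gtn_eqF. Qed.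

Lemma geom_large (i : nat) : (n < i)%N -> G i = 1.
Proof. by move=> lt_ni; rewrite /G -(subnK lt_ni) exprD xn0 mulr0 geom0. Qed.

Lemma sum_weightO (i : nat) :
  \sum_(a < n.+1) (x ^+ i) ^+ a *+ weightO k i a = if (k %| i)%N then 1 else G i.
Proof.
rewrite /weightO; case: ifP => _ /=; last by [].
by rewrite big_ord_recl big1 ?addr0 // => a _; rewrite mulr0n.
Qed.

Lemma mult_gfO :
  mult_gf n x (weightO k) = \prod_(i < n | ~~ (k %| i.+1)%N) G i.+1.
Proof.
rewrite /mult_gf [RHS]big_mkcond; apply: eq_bigr => i _.
by rewrite sum_weightO; case: ifP.
Qed.

(** The part [i] contributes [(1 - x^(ki)) G_i], and the factors [1 - x^(ki)] cancel exactly the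
    [G_i] with [k] dividing [i]. *)
Lemma mult_gfD : mult_gf n x (weightD k) = mult_gf n x (weightO k).
Proof.
rewrite mult_gfO /mult_gf.
under eq_bigr do rewrite sum_geom_lt ?nilpotent_exp // -exprM.
rewrite big_split /= (big_multiples k n (fun i => 1 - x ^+ i)) //; last first.
  by move=> i lt_ni; rewrite -(subnK lt_ni) exprD xn0 mulr0 subr0.
rewrite (bigID (fun i : 'I_n => (k %| i.+1)%N) xpredT) /= mulrA -big_split /=.
by rewrite big1 ?mul1r // => i _; rewrite geomP ?nilpotent_exp.
Qed.

Lemma mult_gf_diff :
  \sum_(j < n)
     mult_gf n x (mark (weightO k) j.+1 (fun a => weightO k j.+1 a * a)%N) =
  \sum_(j < n)
     mult_gf n x (mark (weightD k) j.+1 (fun a => weightD k j.+1 a * a)%N) +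
  (k%:R - 1) * \sum_(j < n | (k %| j.+1)%N)
     mult_gf n x (mark (weightO k) j.+1 (fun a => (0 < a)%N)).
Proof.
set F := mult_gf n x (weightO k).
have sumG j : \sum_(a < n.+1) (x ^+ j) ^+ a *+ (0 < a)%N = G j - 1.
  rewrite /G /geom [in RHS]big_ord_recl big_ord_recl expr0 mulr0n add0r addrC addKr.
  by apply: eq_bigr.
under eq_bigr => j _.
  rewrite (mult_gf_mark n x (if (k %| j.+1)%N then 0 else G j.+1 - 1)) -/F; first over.
  rewrite sum_weightO /weightO; case: ifP => _ /=.
    rewrite mulr0 big1 // => -[[|a] lt_an] _ //=.
  under eq_bigr do rewrite mul1n.
  have yn0 := nilpotent_exp j.+1 isT.
  (* With the bound [n.+1] the condition on [a] is vacuous, and [y ^+ n.+1 = 0] kills the subtracted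
     term. *)
  have := sum_geom_weight n n.+1 (x ^+ j.+1) yn0.
  rewrite yn0 subr0 mul1r geom0 subrr mul0r subr0 => <-.
  by apply: eq_bigr => a _; rewrite ltn_ord mul1n.
rewrite -mulr_sumr.
under [X in _ = X + _]eq_bigr => j _.
  rewrite (mult_gf_mark n x (G j.+1 - 1 - (G (j.+1 * k)%N - 1) * k%:R)).
    rewrite mult_gfD -/F; over.
  rewrite /weightD sum_geom_weight ?nilpotent_exp // -exprM.
  by rewrite sum_geom_lt ?nilpotent_exp // -exprM.
rewrite -mulr_sumr sumrB -mulr_suml.
rewrite (big_multiples k n (fun i => G i - 1)) //; last first.
  by move=> i lt_ni; rewrite geom_large // subrr.
under [X in _ = _ + _ * X]eq_bigr => j k_j.
  rewrite (mult_gf_mark n x (G j.+1 - 1)) -/F; first over.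
  by rewrite sum_weightO k_j mul1r sumG.
(* With [M] and [N] the sums of [G_j - 1] over multiples and non-multiples of [k], the claim becomes
   [F N = F (M + N - k M) + (k - 1) F M]. *)
rewrite -mulr_sumr [X in _ = _ * (X - _) + _]
  (bigID (fun i : 'I_n => (k %| i.+1)%N)) /=.
rewrite (bigID (fun i : 'I_n => (k %| i.+1)%N)) /= big1 => [|j ->] //.
under eq_bigr => j /negPf-> do over.
ring.
Qed.
End TruncatedSeries.

(** * Partitions as vectors of multiplicities *)

Lemma sum_count_mem (n : nat) (s : seq nat) (f : nat -> nat) :
  0%N \notin s -> {in s, forall i, i <= n}%N ->
  (\sum_(i < n) f i.+1 * count_mem i.+1 s = \sum_(i <- s) f i)%N.
Proof.
elim: s => [_ _|[|i] s IH]; first by rewrite big_nil big1 // => i _; rewrite muln0.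
  by rewrite inE eqxx.
rewrite inE /= => s0 le_sn; rewrite big_cons -IH // => [|j js]; last first.
  by apply: le_sn; rewrite inE js orbT.
have lt_in : (i < n)%N by apply: le_sn; rewrite inE eqxx.
under eq_bigr do rewrite mulnDr.
rewrite big_split /= (bigD1 (Ordinal lt_in)) //= eqxx muln1 big1 ?addn0 // => j.
by rewrite -val_eqE /= eqSS eq_sym => /negPf->; rewrite muln0.
Qed.

Lemma partition_le {n : nat} (p : partition_of n) :
  {in (p : seq nat), forall i, i <= n}%N.
Proof.
by move=> i ip; have /and3P[_ _ /eqP<-] := valP p; apply: leq_mem_sumn.
Qed.

Lemma partition_notin0 {n : nat} (p : partition_of n) : 0%N \notin (p : seq nat).
Proof. by have /and3P[] := valP p. Qed.

Lemma sum_count_mem_partition {n : nat} (p : partition_of n) (f : nat -> nat) :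
  (\sum_(i < n) f i.+1 * count_mem i.+1 p = \sum_(i <- p) f i)%N.
Proof. exact: sum_count_mem (partition_notin0 p) (partition_le p). Qed.

Lemma size_partition {n : nat} (p : partition_of n) :
  size p = (\sum_(i < n) count_mem i.+1 p)%N.
Proof.
rewrite -sum1_size -(sum_count_mem_partition p (fun=> 1%N)).
by apply: eq_bigr => i _; rewrite mul1n.
Qed.

Lemma count_partition_le {n : nat} (p : partition_of n) (i : nat) :
  (count_mem i p <= n)%N.
Proof.
have /and3P[_ p0 /eqP sp] := valP p; rewrite -[leqRHS]sp.
exact: leq_trans (count_size _ _) (leq_size_sumn p0).
Qed.

(** This type is the one that indexes the expansion of a product of [n] sums of [n.+1] terms. *)
Definition mults {n : nat} (p : partition_of n) : {ffun 'I_n -> 'I_n.+1} :=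
  [ffun i : 'I_n => inord (count_mem i.+1 p)].

Lemma multsE {n : nat} (p : partition_of n) (i : 'I_n) :
  mults p i = count_mem i.+1 p :> nat.
Proof. by rewrite ffunE inordK // ltnS count_partition_le. Qed.

Lemma geq_total : total geq.
Proof. by move=> i j; apply: leq_total. Qed.

Lemma geq_trans : transitive geq.
Proof. by move=> j i k /= le_ji le_kj; apply: leq_trans le_kj le_ji. Qed.

Lemma geq_anti : antisymmetric geq.
Proof. by move=> i j; rewrite andbC; apply: anti_leq. Qed.

(** Equal multiplicities make the two lists permutations of each other, and a nonincreasing list is
    determined by its multiset. *)
Lemma mults_inj {n : nat} : injective (@mults n).
Proof.
move=> p q eq_pq; apply: val_inj => /=.
have /and3P[sp p0 _] := valP p; have /and3P[sq q0 _] := valP q.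
apply: (sorted_eq geq_trans geq_anti sp sq).
apply/allP => -[|i]; rewrite mem_cat => i_pq /=.
  by move: i_pq; rewrite (negPf p0) (negPf q0).
have lt_in : (i < n)%N by case/orP: i_pq; apply: partition_le.
by rewrite -(multsE p (Ordinal lt_in)) eq_pq multsE.
Qed.

Lemma mults_sum {n : nat} (p : partition_of n) :
  (\sum_(i < n) i.+1 * mults p i)%N = n.
Proof.
under eq_bigr do rewrite multsE.
rewrite (sum_count_mem_partition p id) -sumnE.
by have /and3P[_ _ /eqP] := valP p.
Qed.

Lemma mults_surj {n : nat} (g : {ffun 'I_n -> 'I_n.+1}) :
  (\sum_(i < n) i.+1 * g i)%N = n -> exists p, mults p = g.
Proof.
move=> sum_g.
(* The preimage has [g i] copies of [i.+1] for each [i]. *)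
pose s := sort geq (flatten [seq nseq (g i) (val i).+1 | i <- enum 'I_n]).
have s_part : is_partition n s.
  apply/and3P; split; first exact: sort_sorted geq_total _.
    rewrite mem_sort; apply/flattenP => -[t /mapP[i _ ->]].
    by rewrite mem_nseq andbF.
  rewrite (perm_sumn (permEl (perm_sort _ _))) sumn_flatten sumnE.
  rewrite -[X in _ == X]sum_g 2!big_map big_enum; apply/eqP.
  by apply: eq_bigr => i _; rewrite sumn_nseq.
exists (PartitionOf s_part); apply/ffunP => j; apply: val_inj.
rewrite /= multsE /= (permP (permEl (perm_sort _ _))) count_flatten sumnE 2!big_map.
rewrite big_enum (bigD1 j) //= count_nseq /= eqxx mul1n big1 ?addn0 // => i.
by rewrite count_nseq /= eqSS val_eqE => /negPf->; rewrite mul0n.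
Qed.

(** * Coefficients as weighted counts of partitions *)

(** Expanding the product gives one monomial per vector [g], of degree [\sum_i i.+1 * g i]; the
    vectors of degree [n] are exactly those of the partitions of [n]. *)
Lemma coef_mult_gf {A : comNzRingType} (n : nat) (w : nat -> nat -> nat) :
  (mult_gf n ('X : {poly A}) w)`_n =
    (\sum_(p : partition_of n) \prod_(i < n) w i.+1 (count_mem i.+1 p))%:R.
Proof.
rewrite /mult_gf bigA_distr_bigA coef_sum natr_sum.
have coef_g (g : {ffun 'I_n -> 'I_n.+1}) :
    (\prod_(i < n) ((('X : {poly A}) ^+ i.+1) ^+ g i *+ w i.+1 (g i)))`_n =
    if (\sum_(i < n) i.+1 * g i == n)%N then (\prod_(i < n) w i.+1 (g i))%:R else 0.
  under eq_bigr do rewrite -exprM.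
  rewrite prodrMn prodrXr coefMn coefXn eq_sym.
  by case: ifP; rewrite ?mul0rn.
rewrite (eq_bigr _ (fun g _ => coef_g g)).
(* [mults] has only a partial inverse, defined by choice on its image. *)
rewrite -big_mkcond (reindex_omap (@mults n) (fun g => [pick p | mults p == g])).
  apply: eq_big => [p|p _].
    rewrite mults_sum eqxx /=; case: pickP => [q /eqP/mults_inj-> |/(_ p)].
      by rewrite eqxx.
    by rewrite eqxx.
  by congr _%:R; apply: eq_bigr => i _; rewrite multsE.
move=> g /eqP/mults_surj[p <-].
by case: pickP => [q /eqP/= ->|/(_ p)] //; rewrite eqxx.
Qed.

Lemma prod_mark {n : nat} (c : nat -> nat) (w : nat -> nat -> nat) (j : 'I_n)
    (f : nat -> nat) :
  (\prod_(i < n) mark w j.+1 (fun a => w j.+1 a * f a) i.+1 (c i.+1) =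
   \prod_(i < n) w i.+1 (c i.+1) * f (c j.+1))%N.
Proof.
rewrite (bigD1 j) //= [in RHS](bigD1 j) //= mulnAC /mark eqxx; congr (_ * _)%N.
by apply: eq_bigr => i neq_ij; rewrite eqSS val_eqE (negPf neq_ij).
Qed.

Lemma prod_bool {I : finType} (P b : pred I) :
  (\prod_(i | P i) (b i : nat))%N = [forall (i | P i), b i].
Proof.
have [/forall_inP b1|] := boolP [forall (i | P i), b i].
  by rewrite big1 // => i /b1 ->.
rewrite negb_forall_in => /exists_inP[i Pi /negPf bi].
by rewrite (bigD1 i) //= bi.
Qed.

Lemma prod_weightO {n : nat} (k : nat) (p : partition_of n) :
  (\prod_(i < n) weightO k i.+1 (count_mem i.+1 p))%N = (p \in partitionsO k n).
Proof.
rewrite prod_bool inE; congr nat_of_bool; apply/forall_inP/allP => [wp i ip|wp i _].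
  have := partition_le p i ip; case: i ip => [|i] ip lt_in.
    by case/negP: (partition_notin0 p).
  have := wp (Ordinal lt_in) isT.
  by rewrite -[count_mem _ _ == 0%N]negbK -lt0n -has_count has_pred1 ip orbF.
have [/wp -> //|/count_memPn->] := boolP (i.+1 \in (p : seq nat)).
by rewrite orbT.
Qed.

Lemma prod_weightD {n : nat} (k : nat) (p : partition_of n) : (0 < k)%N ->
  (\prod_(i < n) weightD k i.+1 (count_mem i.+1 p))%N = (p \in partitionsD k n).
Proof.
move=> k0; rewrite prod_bool inE; congr nat_of_bool.
apply/forall_inP/allP => [wp i ip|wp i _].
  have := partition_le p i ip; case: i ip => [|i] ip lt_in.
    by case/negP: (partition_notin0 p).
  exact: wp (Ordinal lt_in) isT.
have [|] := boolP (i.+1 \in (p : seq nat)); first exact: wp.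
by move=> /count_memPn->.
Qed.

(** For a fixed [p] in [S], marking [j.+1] yields its multiplicity, and the multiplicities add up to
    the length. *)
Lemma sum_sizeE {n : nat} (w : nat -> nat -> nat) (S : {set partition_of n}) :
  (forall p : partition_of n, \prod_(i < n) w i.+1 (count_mem i.+1 p) = (p \in S))%N ->
  (\sum_(p in S) size p = \sum_(j < n) \sum_(p : partition_of n)
    \prod_(i < n) mark w j.+1 (fun a => w j.+1 a * a) i.+1 (count_mem i.+1 p))%N.
Proof.
move=> wS; rewrite exchange_big big_mkcond; apply: eq_bigr => p _ /=.
under eq_bigr do rewrite (prod_mark (fun i => count_mem i p) _ _ id) wS.
by rewrite -big_distrr -size_partition /=; case: (p \in S); rewrite ?mul1n ?mul0n.
Qed.

(** For a fixed [p], let [S] be the set of its part values divisible by [k]. The product for [j] is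
    1 exactly when [S] is [{j}], so the sum over [j] tests whether [S] is a singleton. *)
Lemma card_partitionsO1 (k n : nat) :
  (#|partitionsO1 k n| = \sum_(j < n | k %| j.+1) \sum_(p : partition_of n)
    \prod_(i < n) mark (weightO k) j.+1 (fun a => 0 < a) i.+1 (count_mem i.+1 p))%N.
Proof.
rewrite -sum1_card exchange_big big_mkcond; apply: eq_bigr => p _ /=.
pose S := [set j : 'I_n | (k %| j.+1)%N && (j.+1 \in (p : seq nat))].
have -> : p \in partitionsO1 k n = (#|S| == 1%N).
  rewrite inE cardE -(size_map (fun j : 'I_n => j.+1) (enum S)); congr (_ == _).
  apply/perm_size/uniq_perm; first exact: undup_uniq.
    by rewrite map_inj_uniq ?enum_uniq // => i j /succn_inj/val_inj.
  move=> i; rewrite mem_undup mem_filter; apply/andP/mapP => [[k_i ip]|[j]].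
    have := partition_le p i ip; case: i k_i ip => [_|i k_i] ip lt_in.
      by case/negP: (partition_notin0 p).
    by exists (Ordinal lt_in); rewrite ?mem_enum ?inE ?k_i.
  by rewrite mem_enum inE => /andP[? ?] ->.
have prodE (j : 'I_n) : (k %| j.+1)%N -> 
    (\prod_(i < n) mark (weightO k) j.+1 (fun a => 0 < a)
      i.+1 (count_mem i.+1 p) = (S == [set j]))%N.
  (* Each factor tests whether [S] and [{j}] agree at [i]. *)
  move=> k_j; transitivity (\prod_(i < n) ((i \in S) == (i == j)))%N.
    apply: eq_bigr => i _; rewrite /mark eqSS val_eqE inE /weightO.
    have [->|_] := eqVneq i j; first by rewrite k_j -has_count has_pred1 eqb_id.
    rewrite -[_ == 0%N]negbK -lt0n -has_count has_pred1 -negb_and.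
    by case: (_ && _).
  rewrite prod_bool; congr nat_of_bool.
  apply/forall_inP/eqP => [Sj|-> i _]; last by rewrite in_set1.
  by apply/setP => i; rewrite in_set1; apply/eqP/Sj.
rewrite (eq_bigr _ prodE) big_mkcond /=.
transitivity (\sum_(j < n) (S == [set j]))%N; last first.
  apply: eq_bigr => j _; case: ifP => // k_j; case: eqP => // Sj.
  by have := set11 j; rewrite -Sj inE k_j.
case: cards1P => [[i ->]|no_S].
  rewrite (bigD1 i) //= eqxx big1 // => j neq_ji.
  by rewrite eqEsubset sub1set in_set1 eq_sym (negPf neq_ji).
by rewrite big1 // => j _; case: eqP => // Sj; case: no_S; exists j.
Qed.

(** * Reduction modulo [X^(n+1)] and conclusion *)

(** Reduction modulo [X^(n+1)] preserves the coefficients up to degree [n], so they may be compared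
    in the quotient, where [X] is nilpotent. *)
Lemma in_qpoly_coef_inj {R : comNzRingType} (n : nat) (p q : {poly R}) :
  in_qpoly 'X^(n.+1) p = in_qpoly 'X^(n.+1) q -> p`_n = q`_n.
Proof.
move=> /(congr1 (fun r : {poly %/ 'X^(n.+1)} => (val r)`_n)) /=.
by rewrite mk_monic_Xn -!Pdiv.RingMonic.take_poly_rmodp !coef_take_poly ltnSn.
Qed.

Lemma mult_gf_rmorph {A B : comNzRingType} (f : {rmorphism A -> B}) (n : nat)
    (x : A) (w : nat -> nat -> nat) : f (mult_gf n x w) = mult_gf n (f x) w.
Proof.
rewrite rmorph_prod; apply: eq_bigr => i _; rewrite rmorph_sum.
by apply: eq_bigr => a _; rewrite rmorphMn !rmorphXn.
Qed.

Theorem theorem1p6 (k n : nat) (hk : (2 <= k)%N) :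
  (#|partitionsO1 k n|%:R : rat) =
    1 / (k%:R - 1) *
      (\sum_(p in partitionsO k n) (size p)%:R - \sum_(p in partitionsD k n) (size p)%:R).
Proof.
have k0 : (0 < k)%N by apply: leq_trans hk.
have k1 : (k%:R - 1 : rat) != 0 by rewrite subr_eq0 Num.Theory.pnatr_eq1 gtn_eqF.
(* Clearing the denominator and the subtraction gives the shape of [mult_gf_diff]. *)
rewrite div1r; apply: (canRL (mulKf k1)); apply: (canRL (addrK _)).
rewrite -!natr_sum addrC card_partitionsO1.
rewrite (sum_sizeE _ _ (prod_weightO k)).
rewrite (sum_sizeE _ _ (fun p => prod_weightD k p k0)) !natr_sum.
under eq_bigr do rewrite -coef_mult_gf.
under [X in _ + _ * X]eq_bigr do rewrite -coef_mult_gf.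
under [RHS]eq_bigr do rewrite -coef_mult_gf.
rewrite -!coef_sum -coefCM -coefD; apply: in_qpoly_coef_inj.
rewrite [in RHS]rmorph_sum rmorphD rmorphM !rmorph_sum /=.
rewrite rmorphB rmorph_nat rmorph1 rmorphB rmorph_nat rmorph1.
under eq_bigr do rewrite mult_gf_rmorph.
under [X in _ + _ * X]eq_bigr do rewrite mult_gf_rmorph.
under [RHS]eq_bigr do rewrite mult_gf_rmorph.
rewrite mult_gf_diff //.
(* What remains is the nilpotency of the class of [X]. *)
apply: val_inj; rewrite -rmorphXn /= mk_monic_Xn.
by rewrite Pdiv.RingMonic.rmodpp ?monicXn.
Qed.
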